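(* The telescopic extension $\mathcal{T}$, which sends each summation $(D,\mathfrak{S})$ to $(\mathcal{T}D,\mathcal{T}\mathfrak{S})$, is a well-defined functor of summations $\mathcal{T}:\mathbf{Sum}\to\mathbf{Sum}$ and is an idempotent extension map. That is: for every commutative unital ring $R$ with $0\ne 1$, every commutative unital $R$-algebra $E$ with $0\neq 1$, and every summation $(D,\mathfrak{S})$ on $R$ to $E$, the map $\mathcal{T}\mathfrak{S}$ is well defined, $(\mathcal{T}D,\mathcal{T}\mathfrak{S})$ is a summation on $R$ to $E$, and it extends $(D,\mathfrak{S})$; if $\mathfrak{S}\subseteq\mathfrak{S}'$ then $\mathcal{T}\mathfrak{S}\subseteq\mathcal{T}\mathfrak{S}'$; and $\mathcal{T}\mathcal{T}\mathfrak{S}=\mathcal{T}\mathfrak{S}$.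
   Context: Let $R$ be a commutative unital ring with $0\neq 1$ and $E$ a commutative unital $R$-algebra with $0\neq 1$. $R[[\sigma]]$ is the ring of formal power series in $\sigma$ over $R$. A *summation on $R$ to $E$* is a tuple $(R,E,D,\mathfrak{S})$, abbreviated $(D,\mathfrak{S})$ or $\mathfrak{S}$, where $D$ is a set and $\mathfrak{S}:D\to E$ a map such that: (I) $R[\sigma]\subseteq D\subseteq R[[\sigma]]$; (II) $D$ is an $R$-module and $\mathfrak{S}$ is an $R$-module homomorphism; (III) $\mathfrak{S}(1)=1$; (IV) $(1-\sigma)D\subseteq D$ and $\mathfrak{S}$ factors through $D/(1-\sigma)D$ (i.e. $\mathfrak{S}((1-\sigma)X)=0$ for all $X\in D$). For summations $(D,\mathfrak{S})$, $(D',\mathfrak{S}')$ on the same $R$ to the same $E$, $\mathfrak{S}'$ *extends* $\mathfrak{S}$, written $\mathfrak{S}\subseteq\mathfrak{S}'$, if $D\subseteq D'$ and $\mathfrak{S}'|_D=\mathfrak{S}$. $\mathbf{Sum}$ is the posetal category whose objects are all summations and whose morphisms are extensions. A *functor of summations* is a functor $\mathbf{Sum}\to\mathbf{Sum}$; a functor of summations $\mathcal{F}$ is an *extension map* if $\mathcal{F}\mathfrak{S}\supseteq\mathfrak{S}$ for every $\mathfrak{S}$, and *idempotent* if $\mathcal{F}\circ\mathcal{F}=\mathcal{F}$. $\mathrm{Reg}(E)$ is the set of regular elements (non-zerodivisors) of $E$. The *telescopic extension* $(\mathcal{T}D,\mathcal{T}\mathfrak{S})$ of a summation $(D,\mathfrak{S})$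 on $R$ to $E$: a series $X\in R[[\sigma]]$ belongs to $\mathcal{T}D$ iff there exist $A\in D$, $F\in R[\sigma]$, $f\in\mathrm{Reg}(E)$, $x\in E$ with $A=FX$, $\mathfrak{S}(F)=f$ and $\mathfrak{S}(A)=fx$; in that case $\mathcal{T}\mathfrak{S}(X):=x$. *)

(* Defs.v *)
From HB Require Import structures.
From mathcomp Require Import all_boot all_order all_algebra.
From mathcomp Require Import boolp classical_sets.
Set Implicit Arguments.
Unset Strict Implicit.
Unset Printing Implicit Defensive.
Import GRing.Theory.

Local Open Scope classical_set_scope.
Local Open Scope ring_scope.

(* A record rather than a bare function space, so that the Cauchy product
   below cannot be confused with the pointwise product on [nat -> R]. *)
Record fps (R : comNzRingType) := Fps { fps_coef : nat -> R }.

HB.instance Definition _ (R : comNzRingType) := gen_eqMixin (fps R).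
HB.instance Definition _ (R : comNzRingType) := gen_choiceMixin (fps R).

Section FormalPowerSeries.
Variable R : comNzRingType.
Implicit Types X Y Z : fps R.

Definition fps_zero : fps R := Fps (fun=> 0).
Definition fps_one : fps R := Fps (fun n => (n == 0%N)%:R).
Definition fps_opp X : fps R := Fps (fun n => - fps_coef X n).
Definition fps_add X Y : fps R := Fps (fun n => fps_coef X n + fps_coef Y n).
Definition fps_scale (a : R) X : fps R := Fps (fun n => a * fps_coef X n).
Definition fps_mul X Y : fps R :=
  Fps (fun n => \sum_(i < n.+1) fps_coef X i * fps_coef Y (n - i)%N).

Lemma fpsP X Y : fps_coef X =1 fps_coef Y -> X = Y.
Proof. by case: X Y => [x] [y] /= /funext ->. Qed.

Fact fps_addA : associative fps_add.
Proof. by move=> X Y Z; apply: fpsP => n /=; rewrite addrA. Qed.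
Fact fps_addC : commutative fps_add.
Proof. by move=> X Y; apply: fpsP => n /=; rewrite addrC. Qed.
Fact fps_add0 : left_id fps_zero fps_add.
Proof. by move=> X; apply: fpsP => n /=; rewrite add0r. Qed.
Fact fps_addN : left_inverse fps_zero fps_opp fps_add.
Proof. by move=> X; apply: fpsP => n /=; rewrite addNr. Qed.

HB.instance Definition _ :=
  GRing.isZmodule.Build (fps R) fps_addA fps_addC fps_add0 fps_addN.

Let trunc n X : {poly R} := \poly_(i < n.+1) fps_coef X i.

Let coef_trunc n X i : (i <= n)%N -> (trunc n X)`_i = fps_coef X i.
Proof. by move=> le_in; rewrite coef_poly ltnS le_in. Qed.

Let coef_mul n X Y i : (i <= n)%N ->
  fps_coef (fps_mul X Y) i = (trunc n X * trunc n Y)`_i.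
Proof.
move=> le_in; rewrite coefM; apply: eq_bigr => j _.
rewrite !coef_trunc ?(leq_trans (leq_subr _ _)) //.
by rewrite (leq_trans _ le_in) // -ltnS.
Qed.

Fact fps_mulA : associative fps_mul.
Proof.
move=> X Y Z; apply: fpsP => n.
transitivity (trunc n X * (trunc n Y * trunc n Z))`_n.
  rewrite coefM; apply: eq_bigr => i _.
  by rewrite coef_trunc -1?ltnS // (coef_mul _ _ (leq_subr _ _)).
rewrite mulrA coefM; apply: eq_bigr => i _.
by rewrite coef_trunc ?leq_subr // (@coef_mul n) // -ltnS.
Qed.
Fact fps_mulC : commutative fps_mul.
Proof.
by move=> X Y; apply: fpsP => n; rewrite !(@coef_mul n) // mulrC.
Qed.
Fact fps_mul1 : left_id fps_one fps_mul.
Proof.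
move=> X; apply: fpsP => n /=; rewrite big_ord_recl /= mul1r subn0.
by rewrite big1 ?addr0 // => i _; rewrite mul0r.
Qed.
Fact fps_mulDl : left_distributive fps_mul fps_add.
Proof.
move=> X Y Z; apply: fpsP => n /=; rewrite -big_split.
by apply: eq_bigr => i _; rewrite mulrDl.
Qed.
Fact fps_one_neq0 : fps_one != fps_zero.
Proof.
apply/eqP => /(congr1 (fun X => fps_coef X 0%N)) /= /eqP.
by rewrite oner_eq0.
Qed.

HB.instance Definition _ :=
  GRing.Zmodule_isComNzRing.Build (fps R)
    fps_mulA fps_mulC fps_mul1 fps_mulDl fps_one_neq0.

Fact fps_scaleA a b X : fps_scale a (fps_scale b X) = fps_scale (a * b) X.
Proof. by apply: fpsP => n /=; rewrite mulrA. Qed.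
Fact fps_scale1 : left_id 1 fps_scale.
Proof. by move=> X; apply: fpsP => n /=; rewrite mul1r. Qed.
Fact fps_scaleDr : right_distributive fps_scale +%R.
Proof. by move=> a X Y; apply: fpsP => n /=; rewrite mulrDr. Qed.
Fact fps_scaleDl X : {morph fps_scale^~ X : a b / a + b}.
Proof. by move=> a b; apply: fpsP => n /=; rewrite mulrDl. Qed.

HB.instance Definition _ :=
  GRing.Zmodule_isLmodule.Build R (fps R)
    fps_scaleA fps_scale1 fps_scaleDr fps_scaleDl.

End FormalPowerSeries.

Definition fps_of_poly (R : comNzRingType) (p : {poly R}) : fps R :=
  Fps (fun n => p`_n).

Definition fps_sigma (R : comNzRingType) : fps R := fps_of_poly 'X.

(* A pair (D, S) of a set D of power series and a map S : D -> E, with no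
   further condition.  The target [comAlgType R] is nontrivial. *)
Record series_map (R : comNzRingType) (E : comAlgType R) := SeriesMap {
  sdom : set (fps R);
  sfun :> sdom -> E
}.

(* [maps_to S X x]: X belongs to D and S(X) = x. *)
Definition maps_to (R : comNzRingType) (E : comAlgType R)
    (S : series_map E) (X : fps R) (x : E) : Prop :=
  exists X' : sdom S, val X' = X /\ S X' = x.

Record is_summation (R : comNzRingType) (E : comAlgType R)
    (S : series_map E) : Prop := IsSummation {
  summation_poly : forall p : {poly R}, fps_of_poly p \in sdom S;
  summation_submod : GRing.submod_closed [in sdom S];
  summation_linear : forall (a : R) (X Y Z : sdom S),
    val Z = a *: val X + val Y -> S Z = a *: S X + S Y;
  summation_one : maps_to S 1 1;
  summation_shift : forall X : sdom S,
    maps_to S ((1 - fps_sigma R) * val X) 0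
}.

Record summation (R : comNzRingType) (E : comAlgType R) := Summation {
  summation_map :> series_map E;
  summation_axioms : is_summation summation_map
}.

Definition extends (R : comNzRingType) (E : comAlgType R)
    (S S' : series_map E) : Prop :=
  sdom S `<=` sdom S' /\
  forall (X : sdom S) (X' : sdom S'), val X' = val X -> S' X' = S X.

(* An object of the category of all summations, over varying R and E. *)
Record Sum := SumObj {
  sum_base : comNzRingType;
  sum_target : comAlgType sum_base;
  sum_summation : summation sum_target
}.

(* There are morphisms only between summations on the same R to the same E. *)
Variant sum_extends : Sum -> Sum -> Prop :=
  SumExtends (R : comNzRingType) (E : comAlgType R) (S S' : summation E) :
    extends S S' -> sum_extends (SumObj S) (SumObj S').

(* Since the category is posetal, a functor is a monotone map on objects. *)
Record sum_functor := SumFunctor {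
  functor_obj :> Sum -> Sum;
  functor_mono : forall S S' : Sum,
    sum_extends S S' -> sum_extends (functor_obj S) (functor_obj S')
}.

Definition extension_map (F : sum_functor) : Prop :=
  forall S : Sum, sum_extends S (F S).

Definition idempotent_functor (F : sum_functor) : Prop :=
  forall S : Sum, F (F S) = F S.

(* The relation "X belongs to the telescopic domain, with value x".  As E is
   commutative, [GRing.lreg f] says that f is not a zero divisor. *)
Definition telescopic_graph (R : comNzRingType) (E : comAlgType R)
    (S : series_map E) (X : fps R) (x : E) : Prop :=
  exists (A : fps R) (F : {poly R}) (f : E),
    [/\ A = fps_of_poly F * X, GRing.lreg f,
        maps_to S (fps_of_poly F) f & maps_to S A (f * x)].

(* [xget] selects some value x related to X: one exists on this domain (so the
   default 0 is never used), but uniqueness is not part of the definition. *)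
Definition telescopic (R : comNzRingType) (E : comAlgType R)
    (S : series_map E) : series_map E :=
  @SeriesMap R E [set X | exists x, telescopic_graph S X x]
    (fun X => xget 0 [set x | telescopic_graph S (val X) x]).

(* Main.v *)
(** If [D] is the domain of a summation [S], then [S (sigma X) = S X], so [D] is
    stable under multiplication by a polynomial [F] and [S (F X) = F(1) S X].
    Thus [x] is the telescopic value of [X] iff [S (F X) = F(1) x] for some [F]
    with [F(1)] regular in [E].  Regular elements being closed under products,
    two such polynomials [F] and [G] can be replaced by the common multiple
    [F G]: this gives uniqueness and linearity, and merges two successive
    telescopic steps into one. *)
Require Import Defs.
From HB Require Import structures.
From mathcomp Require Import all_boot all_order all_algebra.
From mathcomp Require Import boolp classical_sets.
Set Implicit Arguments.
Unset Strict Implicit.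
Unset Printing Implicit Defensive.
Import GRing.Theory.

Local Open Scope classical_set_scope.
Local Open Scope ring_scope.

Section FpsOfPoly.
Variable R : comNzRingType.
Implicit Types (p q : {poly R}) (a : R) (X : fps R).

Lemma fps_of_polyM p q : fps_of_poly (p * q) = fps_of_poly p * fps_of_poly q.
Proof. by apply: fpsP => n /=; rewrite coefM. Qed.

Lemma fps_of_polyD p q : fps_of_poly (p + q) = fps_of_poly p + fps_of_poly q.
Proof. by apply: fpsP => n /=; rewrite coefD. Qed.

Lemma fps_of_poly0 : fps_of_poly 0 = 0 :> fps R.
Proof. by apply: fpsP => n /=; rewrite coef0. Qed.

Lemma fps_of_poly1 : fps_of_poly 1 = 1 :> fps R.
Proof. by apply: fpsP => n /=; rewrite coef1. Qed.

Lemma fps_of_polyCM a X : fps_of_poly a%:P * X = a *: X.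
Proof.
apply: fpsP => n /=; rewrite big_ord_recl /= coefC /= subn0.
by rewrite big1 ?addr0 // => i _; rewrite coefC mul0r.
Qed.

Lemma fps_scalerAr a X (Y : fps R) : X * (a *: Y) = a *: (X * Y).
Proof. by rewrite -!fps_of_polyCM mulrCA. Qed.

End FpsOfPoly.

Section SeriesMap.
Variables (R : comNzRingType) (E : comAlgType R).
Implicit Types (S : series_map E) (X Y : fps R) (x y : E).

Lemma maps_to_sfun S (X : sdom S) : maps_to S (val X) (S X).
Proof. by exists X. Qed.

Lemma maps_to_sdom S X x : maps_to S X x -> X \in sdom S.
Proof. by case=> X' [<- _]; apply: valP. Qed.

Lemma sdom_maps_to S X : X \in sdom S -> exists x, maps_to S X x.
Proof. by move=> XD; exists (S (Sub X XD)), (Sub X XD). Qed.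

Lemma maps_to_inj S X x y : maps_to S X x -> maps_to S X y -> x = y.
Proof. by case=> X1 [<- <-] [X2 [/val_inj -> <-]]. Qed.

(** Passing to graphs replaces functions on the subtypes [sdom S] and [sdom S'] by relations on
    [fps R], so that later arguments carry no membership proofs. *)
Lemma extendsP S S' :
  extends S S' <-> forall X x, maps_to S X x -> maps_to S' X x.
Proof.
split=> [[sDD' eSS'] X x XS | sSS'].
  have /set_mem/sDD'/mem_set XD' := maps_to_sdom XS.
  case: XS => X1 [eX <-]; exists (Sub X XD'); split=> //.
  by apply: eSS'; rewrite eX.
split=> [X /mem_set/sdom_maps_to [x /sSS'/maps_to_sdom/set_mem] // | X X' eX].
apply: (@maps_to_inj S' (val X)); last exact/sSS'/maps_to_sfun.
by rewrite -eX; apply: maps_to_sfun.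
Qed.

Lemma extends_antisym S S' : extends S S' -> extends S' S -> S = S'.
Proof.
case: S S' => [D s] [D' s'] [/= sDD' ss'] [/= sD'D _].
have eDD' : D = D' by apply/seteqP.
(* The type of [s'] depends on [D'], so the domains must be identified before the two functions can
   be compared. *)
case: D' / eDD' s' {sDD' sD'D} ss' => s' ss'.
by have -> : s' = s by apply/funext => X; apply: ss'.
Qed.

Lemma summation_inj (S S' : summation E) :
  summation_map S = summation_map S' -> S = S'.
Proof.
case: S S' => [S ax] [S' ax'] /= eS.
by case: S' / eS ax' => ax'; congr Summation; apply: Prop_irrelevance.
Qed.

(** Meant for [telescopic S], whose values are easier to handle through their graph than through
    [xget]. *)
Lemma is_summation_maps_to S :
    (forall p : {poly R}, exists x, maps_to S (fps_of_poly p) x) ->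
    (forall (a : R) X Y x y, maps_to S X x -> maps_to S Y y ->
       maps_to S (a *: X + Y) (a *: x + y)) ->
    maps_to S 1 1 ->
    (forall X x, maps_to S X x -> maps_to S ((1 - fps_sigma R) * X) 0) ->
  is_summation S.
Proof.
move=> Spoly Slin S1 Sshift; split=> //.
- by move=> p; have [x /maps_to_sdom] := Spoly p.
- split=> [|a X Y /sdom_maps_to [x Xx] /sdom_maps_to [y Yy]].
    by have [x /maps_to_sdom] := Spoly 0; rewrite fps_of_poly0.
  exact: maps_to_sdom (Slin a _ _ _ _ Xx Yy).
- move=> a X Y Z eZ; apply: (maps_to_inj (maps_to_sfun Z)).
  by rewrite eZ; apply: Slin; apply: maps_to_sfun.
- by move=> X; apply: (Sshift _ (S X)); apply: maps_to_sfun.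
Qed.

End SeriesMap.

Section Summation.
Variables (R : comNzRingType) (E : comAlgType R) (S : summation E).
Implicit Types (F G p : {poly R}) (X Y : fps R) (x y : E).

Lemma maps_to_linear (a : R) X Y x y :
  maps_to S X x -> maps_to S Y y -> maps_to S (a *: X + Y) (a *: x + y).
Proof.
have [_ [_ Dlin] Slin _ _] := summation_axioms S.
move=> XS YS; have := Dlin a _ _ (maps_to_sdom XS) (maps_to_sdom YS).
case: XS YS => [X' [<- <-]] [Y' [<- <-]] ZD.
by exists (Sub (a *: val X' + val Y') ZD); split=> //; apply: Slin.
Qed.

Lemma maps_to_shift X x :
  maps_to S X x -> maps_to S ((1 - fps_sigma R) * X) 0.
Proof. by case=> X' [<- _]; apply: summation_shift (summation_axioms S) X'. Qed.

Lemma maps_to0 : maps_to S 0 0.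
Proof.
have := maps_to_linear (-1) (summation_one (summation_axioms S))
          (summation_one (summation_axioms S)).
by rewrite !scaleN1r !addNr.
Qed.

(** Write sigma X as X - (1 - sigma) X; the subtracted term has sum 0. *)
Lemma maps_to_sigma X x : maps_to S X x -> maps_to S (fps_sigma R * X) x.
Proof.
move=> XS; have := maps_to_linear (-1) (maps_to_shift XS) XS.
by rewrite scaler0 add0r scaleN1r mulrBl mul1r opprB subrK.
Qed.

(** Horner induction on [F]: multiplication by sigma keeps the sum, so every power of sigma acts as
    1, whence the evaluation at 1. *)
Lemma maps_to_polyM F X x :
  maps_to S X x -> maps_to S (fps_of_poly F * X) (F.[1] *: x).
Proof.
move=> XS; elim/poly_ind: F => [|F c IH].
  by rewrite fps_of_poly0 horner0 mul0r scale0r; apply: maps_to0.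
rewrite hornerMXaddC mulr1 scalerDl [_ + c *: x]addrC.
rewrite fps_of_polyD fps_of_polyM mulrDl fps_of_polyCM [_ + c *: X]addrC.
by apply: maps_to_linear => //; rewrite mulrAC mulrC; apply: maps_to_sigma.
Qed.

Lemma maps_to_poly F : maps_to S (fps_of_poly F) F.[1]%:A.
Proof.
rewrite -[fps_of_poly F]mulr1; apply: maps_to_polyM.
exact: summation_one (summation_axioms S).
Qed.

(** The sum of [F] can only be F(1), so [f] disappears and the regularity condition depends on [F]
    and [E] but not on [S]. This lets the same [F] serve for different summations. *)
Lemma telescopic_graphP X x :
  telescopic_graph S X x <->
  exists2 F, GRing.lreg (F.[1]%:A : E)
           & maps_to S (fps_of_poly F * X) (F.[1] *: x).
Proof.
split=> [[A [F [f [-> freg FS XS]]]] | [F Freg XS]].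
  have ef := maps_to_inj FS (maps_to_poly F); subst f.
  by exists F => //; rewrite mulr_algl in XS.
exists (fps_of_poly F * X), F, F.[1]%:A; split=> //; first exact: maps_to_poly.
by rewrite mulr_algl.
Qed.

(** Evaluation at 1 and the structure map from [R] to [E] are multiplicative, and a product of
    regular elements is regular. *)
Lemma lreg_horner1M F G :
    GRing.lreg (F.[1]%:A : E) -> GRing.lreg (G.[1]%:A : E) ->
  GRing.lreg ((F * G).[1]%:A : E).
Proof. by move=> Freg Greg; rewrite hornerM -in_algE rmorphM; apply: lregM. Qed.

Lemma telescopic_graph_inj X x y :
  telescopic_graph S X x -> telescopic_graph S X y -> x = y.
Proof.
move=> /telescopic_graphP [F Freg FX] /telescopic_graphP [G Greg GX].
(* After multiplication by F(1) G(1), both sides are the sum of F G X. *)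
apply: (lreg_horner1M Freg Greg); rewrite !mulr_algl hornerM.
have := maps_to_polyM F GX; rewrite scalerA => /(maps_to_inj _); apply.
by have := maps_to_polyM G FX; rewrite scalerA mulrCA [G.[1] * _]mulrC.
Qed.

(** The value picked by [xget] is always related to [X]; conversely, uniqueness forces the picked
    value to be the given [x]. *)
Lemma maps_to_telescopic X x :
  maps_to (telescopic S) X x <-> telescopic_graph S X x.
Proof.
have xgetP (X' : sdom (telescopic S)) :
    telescopic_graph S (val X') (telescopic S X').
  by have /set_mem [y yX] := valP X'; apply: (xgetPex 0 (ex_intro _ y yX)).
split=> [[X' [<- <-]] // | Xx].
have XD : X \in sdom (telescopic S) by apply/mem_set; exists x.
exists (Sub X XD); split=> //; apply: (telescopic_graph_inj _ Xx).
exact: (xgetP (Sub X XD)).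
Qed.

Lemma extends_telescopic : extends S (telescopic S).
Proof.
apply/extendsP => X x XS; apply/maps_to_telescopic/telescopic_graphP; exists 1.
  by rewrite hornerC scale1r; apply: lreg1.
exact: maps_to_polyM.
Qed.

Lemma telescopic_is_summation : is_summation (telescopic S).
Proof.
have /extendsP sST := extends_telescopic.
apply: is_summation_maps_to => [p|a X Y x y|| X x].
- by exists p.[1]%:A; apply: sST; apply: maps_to_poly.
- move=> /maps_to_telescopic /telescopic_graphP [F Freg FX].
  move=> /maps_to_telescopic /telescopic_graphP [G Greg GY].
  apply/maps_to_telescopic/telescopic_graphP.
  (* F G (a X + Y) = a G (F X) + F (G Y), where F X and G Y lie in the domain of [S]. *)
  exists (F * G); first exact: lreg_horner1M.
  have := maps_to_linear a (maps_to_polyM G FX) (maps_to_polyM F GY).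
  rewrite !mulrA [fps_of_poly G * _]mulrC !scalerA -[a * _ * _]mulrA.
  rewrite [G.[1] * _]mulrC fps_of_polyM mulrDr fps_scalerAr hornerM.
  by rewrite [in X in _ -> X]scalerDr !scalerA [_ * a]mulrC.
- by apply: sST; apply: summation_one (summation_axioms S).
- move=> /maps_to_telescopic /telescopic_graphP [F Freg FX].
  (* The same [F] works: F (1 - sigma) X = (1 - sigma) (F X) has sum 0 = F(1) 0. *)
  apply/maps_to_telescopic/telescopic_graphP; exists F => //.
  by rewrite scaler0 mulrCA; apply: maps_to_shift FX.
Qed.

End Summation.

Lemma telescopic_mono (R : comNzRingType) (E : comAlgType R)
    (S S' : summation E) :
  extends S S' -> extends (telescopic S) (telescopic S').
Proof.
move=> /extendsP sSS'; apply/extendsP => X x.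
move=> /maps_to_telescopic /telescopic_graphP [F Freg FX].
apply/maps_to_telescopic/telescopic_graphP; exists F => //; exact: sSS'.
Qed.

Definition telescopic_summation (R : comNzRingType) (E : comAlgType R)
    (S : summation E) : summation E :=
  Summation (telescopic_is_summation S).

Lemma telescopic_idem (R : comNzRingType) (E : comAlgType R)
    (S : summation E) :
  telescopic_summation (telescopic_summation S) = telescopic_summation S.
Proof.
(* One inclusion is the extension property, applied to the telescopic extension itself. *)
apply/summation_inj/extends_antisym; last exact: extends_telescopic.
apply/extendsP => X x /maps_to_telescopic /telescopic_graphP [F Freg].
move=> /maps_to_telescopic /telescopic_graphP [G Greg GFX].
apply/maps_to_telescopic/telescopic_graphP.
(* [F] brings X into the telescopic domain, and [G] then brings F X into the domain of [S]. *)
exists (G * F); first exact: lreg_horner1M.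
by rewrite fps_of_polyM hornerM -mulrA -scalerA.
Qed.

Definition telescopic_obj (S : Sum) : Sum :=
  SumObj (telescopic_summation (sum_summation S)).

Lemma telescopic_obj_mono (S S' : Sum) :
  sum_extends S S' -> sum_extends (telescopic_obj S) (telescopic_obj S').
Proof.
(* The case analysis puts both summations over the same [R] and [E]. *)
by case=> R E {}S {}S' sSS'; apply: SumExtends; apply: telescopic_mono.
Qed.

Theorem theorem2p2 :
  (forall (R : comNzRingType) (E : comAlgType R) (S : summation E)
      (X : fps R) (x y : E),
    telescopic_graph S X x -> telescopic_graph S X y -> x = y) /\
  (exists T : sum_functor,
    (forall (R : comNzRingType) (E : comAlgType R) (S : summation E),
      exists TS : is_summation (telescopic S),
        T (SumObj S) = SumObj (Summation TS)) /\
    extension_map T /\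
    idempotent_functor T).
Proof.
split; first exact: telescopic_graph_inj.
exists (SumFunctor telescopic_obj_mono); split; [|split].
- by move=> R E S; exists (telescopic_is_summation S).
- by case=> R E S; apply: SumExtends; apply: extends_telescopic.
- by case=> R E S; rewrite /= /telescopic_obj /= telescopic_idem.
Qed.
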